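(* Let $R$ be a reduced commutative ring with $1\neq 0$. If $I$ is a nonzero weakly 1-absorbing primary ideal of $R$, then $\sqrt{I}$ is a prime ideal of $R$. In particular, if $\sqrt{I}$ is a maximal ideal of $R$, then $I$ is a primary ideal of $R$, and hence $I$ is a 1-absorbing primary ideal of $R$.
   Context: All rings are commutative with $1\neq 0$. For an ideal $I$ of $R$, $\sqrt{I}=\{a\in R : a^n\in I \text{ for some positive integer } n\}$. A ring is reduced if it has no nonzero nilpotent elements. A proper ideal $I$ of $R$ is called weakly 1-absorbing primary if whenever $a,b,c\in R$ are nonunit elements and $0\neq abc\in I$, then $ab\in I$ or $c\in\sqrt{I}$. A proper ideal $I$ of $R$ is called 1-absorbing primary if whenever $a,b,c\in R$ are nonunit elements and $abc\in I$, then $ab\in I$ or $c\in\sqrt{I}$. *)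

(* Defs.v *)
From mathcomp Require Import all_boot all_algebra.
From mathcomp Require Import boolp.

Set Implicit Arguments.
Unset Strict Implicit.
Unset Printing Implicit Defensive.

Import GRing.Theory.
Local Open Scope ring_scope.

(* Subsets of a ring are predicates {pred R}; by the classical axioms of boolp
   every subset has this form.  [idealr_closed I] of ring_quotient.v includes
   1 \notin I, so it says that I is a proper ideal. *)

Definition reduced_ring (R : comNzRingType) : Prop :=
  forall (x : R) (n : nat), (0 < n)%N -> x ^+ n = 0 -> x = 0.

(* An arbitrary comNzRingType carries no GRing.unit predicate. *)
Definition nonunit (R : comNzRingType) (x : R) : Prop :=
  ~ exists y : R, x * y = 1.

Definition radical (R : comNzRingType) (I : {pred R}) : {pred R} :=
  fun a : R => `[< exists2 n : nat, (0 < n)%N & a ^+ n \in I >].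

Definition nonzero_ideal (R : comNzRingType) (I : {pred R}) : Prop :=
  exists2 x : R, x \in I & x != 0.

Definition prime_ideal (R : comNzRingType) (P : {pred R}) : Prop :=
  idealr_closed P /\ prime_idealr_closed P.

Definition maximal_ideal (R : comNzRingType) (M : {pred R}) : Prop :=
  idealr_closed M /\
  forall J : {pred R}, idealr_closed J -> {subset M <= J} -> J =i M.

Definition primary_ideal (R : comNzRingType) (Q : {pred R}) : Prop :=
  idealr_closed Q /\
  forall a b : R, a * b \in Q -> a \in Q \/ b \in radical Q.

Definition one_absorbing_primary (R : comNzRingType) (I : {pred R}) : Prop :=
  idealr_closed I /\
  forall a b c : R, nonunit a -> nonunit b -> nonunit c ->
    a * b * c \in I -> a * b \in I \/ c \in radical I.

Definition weakly_one_absorbing_primary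
    (R : comNzRingType) (I : {pred R}) : Prop :=
  idealr_closed I /\
  forall a b c : R, nonunit a -> nonunit b -> nonunit c ->
    a * b * c != 0 -> a * b * c \in I -> a * b \in I \/ c \in radical I.

(* Main.v *)
Require Import Defs.
From mathcomp Require Import all_boot all_algebra.
From mathcomp Require Import boolp.

(**
If [a * b] lies in the radical of [I] and is nonzero, then [(a * b) ^+ (2 * n)]
is a nonzero element of [I] by reducedness, and the defining property applied
to [a ^+ n], [a ^+ n], [b ^+ (2 * n)] puts [a] or [b] in the radical.
If [a * b = 0], pick [i != 0] in [I]: one of [a * (b + i) = a * i],
[(a + i) * b = i * b] and, when both vanish, [(a + i) * (b + i) = i ^+ 2] is
nonzero, and adding [i] does not change membership in the radical.
*)

Set Implicit Arguments.
Unset Strict Implicit.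
Unset Printing Implicit Defensive.

Import GRing.Theory.
Local Open Scope ring_scope.

Section Ideals.
Variables (R : comNzRingType) (I : {pred R}).
Hypothesis idI : idealr_closed I.

Lemma ideal_mull (a x : R) : x \in I -> a * x \in I.
Proof. by case: idI => I0 _ IC Ix; rewrite -[a * x]addr0 IC. Qed.

Lemma ideal_add (x y : R) : x \in I -> y \in I -> x + y \in I.
Proof. by case: idI => _ _ IC Ix Iy; rewrite -[x]mul1r IC. Qed.

Lemma ideal_mulr (a x : R) : x \in I -> x * a \in I.
Proof. by rewrite mulrC; apply: ideal_mull. Qed.

Lemma radicalP (a : R) :
  reflect (exists2 n, (0 < n)%N & a ^+ n \in I) (a \in radical I).
Proof. exact: asboolP. Qed.

Lemma ideal_sub_radical (x : R) : x \in I -> x \in radical I.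
Proof. by move=> Ix; apply/radicalP; exists 1%N; rewrite ?expr1. Qed.

Lemma radical_exp (a : R) (n : nat) :
  (0 < n)%N -> a ^+ n \in radical I -> a \in radical I.
Proof.
move=> n_gt0 /radicalP[m m_gt0 Iam]; apply/radicalP; exists (n * m)%N.
  by rewrite muln_gt0 n_gt0.
by rewrite exprM.
Qed.

(** If [u ^+ n] and [v ^+ m] lie in [I], every term of the binomial expansion of
    [(a * u + v) ^+ (n + m)] contains one of them as a factor. *)
Lemma radical_idealr_closed : idealr_closed (radical I).
Proof.
have [I0 I1 _] := idI; split.
- exact: ideal_sub_radical.
- by apply/negP => /radicalP[n _]; rewrite expr1n; apply/negP.
move=> a u v /radicalP[n n_gt0 Iun] /radicalP[m m_gt0 Ivm].
apply/radicalP; exists (n + m)%N; first by rewrite addn_gt0 n_gt0.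
rewrite exprDn; elim/big_ind: _ => // [x y|i _]; first exact: ideal_add.
rewrite -mulr_natl; apply: ideal_mull.
(* The term of index [i] carries [u] to the power [n + m - i], which is at least [n] when [i <= m],
   and [v] to the power [i]. *)
have [le_im|lt_mi] := leqP i m.
  apply: ideal_mulr.
  rewrite exprMn -(subnK (_ : n <= n + m - i)%N); last first.
    by rewrite -addnBA // leq_addr.
  by rewrite (exprD u) mulrA; apply: ideal_mull.
by apply: ideal_mull; rewrite -(subnK (ltnW lt_mi)) exprD; apply: ideal_mull.
Qed.

End Ideals.

(** Otherwise [M + bR] would be a proper ideal containing [M], hence equal to [M] by maximality,
    although it contains [b]. *)
Lemma maximal_ideal_bezout (R : comNzRingType) (M : {pred R}) (b : R) :
  maximal_ideal M -> b \notin M ->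
  exists s r : R, s \in M /\ s + b * r = 1.
Proof.
move=> [idM maxM] Mb; apply: contrapT => noBezout.
pose J : {pred R} := fun x => `[< exists s r, s \in M /\ s + b * r = x >].
have JP x : reflect (exists s r, s \in M /\ s + b * r = x) (x \in J).
  exact: asboolP.
have [M0 _ MC] := idM.
have idJ : idealr_closed J.
  split.
  - by apply/JP; exists 0, 0; rewrite mulr0 addr0.
  (* Properness of [J] is exactly [noBezout]. *)
  - by apply/negP => /JP.
  move=> a u v /JP[s [r [Ms <-]]] /JP[s' [r' [Ms' <-]]].
  apply/JP; exists (a * s + s'), (a * r + r'); split; first exact: MC.
  by rewrite !mulrDr addrACA [b * (a * r)]mulrCA.
have subMJ : {subset M <= J}.
  by move=> x Mx; apply/JP; exists x, 0; rewrite mulr0 addr0.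
case/negP: Mb; rewrite -(maxM J idJ subMJ).
by apply/JP; exists 0, 1; rewrite mulr1 add0r.
Qed.

(** If [b] is outside the radical, then [s + b * r = 1] with some [s ^+ n] in [I]. Modulo [I], [a]
    equals [a * (1 - s ^+ n)], a multiple of [a * b]. *)
Lemma maximal_radical_primary (R : comNzRingType) (I : {pred R}) :
  idealr_closed I -> maximal_ideal (radical I) -> primary_ideal I.
Proof.
move=> idI maxI; split=> // a b Iab.
have [rb|rb] := boolP (b \in radical I); first by right.
left; have [s [r [/radicalP[n _ Isn] sbr]]] := maximal_ideal_bezout maxI rb.
have br : b * r = 1 - s by rewrite -sbr addrC addKr.
(* The geometric sum factors [1 - s ^+ n] through [1 - s = b * r]. *)
have -> : a = a * s ^+ n + a * b * (r * \sum_(i < n) s ^+ i).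
  rewrite -[a * b * _]mulrA -mulrDr mulrA br -opprB mulNr -subrX1 opprB.
  by rewrite addrC subrK mulr1.
by apply: ideal_add; [|apply: ideal_mull|apply: ideal_mulr].
Qed.

Section WeaklyOneAbsorbing.
Variables (R : comNzRingType) (I : {pred R}).
Hypothesis redR : reduced_ring R.
Hypothesis wI : weakly_one_absorbing_primary I.

Lemma radical_prime_nonzero (a b : R) :
  a * b != 0 -> a * b \in radical I -> a \in radical I \/ b \in radical I.
Proof.
have idI : idealr_closed I by case: wI.
have idr := radical_idealr_closed idI.
move=> ab0 rab.
(* The defining property concerns nonunits only. If one factor is a unit, the other is a multiple of
   [a * b], hence in the radical. *)
have [[y ay]|a_nonunit] := pselect (exists y, a * y = 1).
  right; have -> : b = y * (a * b) by rewrite mulrA [y * a]mulrC ay mul1r.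
  exact: ideal_mull.
have [[y b_y]|b_nonunit] := pselect (exists y, b * y = 1).
  left; have -> : a = a * b * y by rewrite -mulrA b_y mulr1.
  exact: ideal_mulr.
have nonunitX (x : R) n : (0 < n)%N -> nonunit x -> nonunit (x ^+ n).
  case: n => // n _ xN [y xy]; apply: xN; exists (x ^+ n * y).
  by rewrite mulrA -exprS.
have /radicalP[n n_gt0 Iabn] := rab.
have n2_gt0 : (0 < n + n)%N by rewrite addn_gt0 n_gt0.
have E : a ^+ n * a ^+ n * b ^+ (n + n) = (a * b) ^+ (n + n).
  by rewrite -exprD -exprMn.
have E0 : a ^+ n * a ^+ n * b ^+ (n + n) != 0.
  by rewrite E; apply: contra ab0 => /eqP /(redR n2_gt0) ->.
have EI : a ^+ n * a ^+ n * b ^+ (n + n) \in I.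
  by rewrite E exprD; apply: ideal_mull.
have aXN := nonunitX _ _ n_gt0 a_nonunit.
have bXN := nonunitX _ _ n2_gt0 b_nonunit.
have [Iaa|rb] := wI.2 _ _ _ aXN aXN bXN E0 EI; last by right; apply: radical_exp rb.
by left; apply/radicalP; exists (n + n)%N; rewrite // exprD.
Qed.

Lemma radical_prime : nonzero_ideal I -> prime_ideal (radical I).
Proof.
have idI : idealr_closed I by case: wI.
have idr := radical_idealr_closed idI.
move=> [i Ii i0]; split=> // a b rab.
have ri := ideal_sub_radical Ii.
have subi x : x + i \in radical I -> x \in radical I.
  by move=> rxi; rewrite -(addrK i x) -mulN1r; apply: ideal_add => //;
    apply: ideal_mull.
apply/orP; have [ab0|ab0] := eqVneq (a * b) 0; last first.
  exact: radical_prime_nonzero.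
have [ai0|ai0] := eqVneq (a * i) 0; last first.
  have E : a * (b + i) = a * i by rewrite mulrDr ab0 add0r.
  have [||ra|/subi rb] := @radical_prime_nonzero a (b + i); rewrite ?E //.
  - exact: ideal_mull.
  - by left.
  - by right.
have [ib0|ib0] := eqVneq (i * b) 0; last first.
  have E : (a + i) * b = i * b by rewrite mulrDl ab0 add0r.
  have [||/subi ra|rb] := @radical_prime_nonzero (a + i) b; rewrite ?E //.
  - exact: ideal_mulr.
  - by left.
  - by right.
have E : (a + i) * (b + i) = i ^+ 2.
  by rewrite mulrDr !mulrDl ab0 ib0 ai0 !add0r expr2.
have [||/subi ra|/subi rb] := @radical_prime_nonzero (a + i) (b + i);
  rewrite ?E.
(* Reducedness keeps [i ^+ 2] nonzero. *)
- by apply: contra i0 => /eqP /redR ->.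
- by rewrite expr2; apply: ideal_mull.
- by left.
- by right.
Qed.

End WeaklyOneAbsorbing.

Theorem theorem3 (R : comNzRingType) (I : {pred R}) :
  reduced_ring R ->
  nonzero_ideal I ->
  weakly_one_absorbing_primary I ->
  prime_ideal (radical I) /\
  (maximal_ideal (radical I) -> primary_ideal I /\ one_absorbing_primary I).
Proof.
move=> redR nzI wI; split; first exact: radical_prime.
have [idI _] := wI => /(maximal_radical_primary idI) primI.
(* Primariness is applied to the two factors [a * b] and [c]. *)
split=> //; split=> // a b c _ _ _; exact: primI.2.
Qed.
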